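(* Let $D\in\mathbb{R}^{n\times n}$ be symmetric and $z\in\mathcal{S}$. The Dirac measure $\mu^*=\delta_z$ is a stationary point of $\mathcal{E}_D$ if and only if $z$ is an eigenvector of $D$.
   Context: $\mathcal{S}=\{x\in\mathbb{R}^n:\|x\|=1\}$ is the Euclidean unit sphere, $P_x^\perp=\mathrm{Id}-xx^T$ for $x\in\mathcal{S}$, and $\mathcal{E}_D(\mu)=\int_{\mathcal{S}}\int_{\mathcal{S}}e^{x\cdot Dy}\,d\mu(x)\,d\mu(y)$ for Borel probability measures $\mu$ on $\mathcal{S}$. For a Lipschitz vector field $V:\mathbb{R}^n\to\mathbb{R}^n$, the first variation is $d\mathcal{E}_D(\mu;V)=\frac{d}{dt}\mathcal{E}_D(\mu_t)\big|_{t=0}$, where $\mu_t$ is the (unique) weak solution of $\partial_t\mu_t+\nabla\cdot(\mu_tP_x^\perp V)=0$, $\mu_0=\mu$, i.e. $\frac{d}{dt}\int_{\mathcal{S}}\varphi\,d\mu_t=\int_{\mathcal{S}}P_x^\perp\nabla\varphi(x)\cdot V(x)\,d\mu_t(x)$ for continuously differentiable $\varphi$. A probability measure $\mu$ on $\mathcal{S}$ is a stationary point of $\mathcal{E}_D$ if $d\mathcal{E}_D(\mu;V)=0$ for all Lipschitz continuous $V$. *)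

(* Defs.v *)
From HB Require Import structures.
From mathcomp Require Import all_boot all_order all_algebra.
From mathcomp Require Import all_classical all_reals all_analysis.

Set Implicit Arguments.
Unset Strict Implicit.
Unset Printing Implicit Defensive.

Import Order.TTheory GRing.Theory Num.Theory.
Import numFieldNormedType.Exports.

Local Open Scope classical_set_scope.
Local Open Scope ring_scope.

(* The library norm on 'cV[R]_n is the max norm; it is used below only through
   the topology and the differential structure of R^n, on which it agrees with
   the Euclidean norm. *)
Definition dotp (R : realType) (n : nat) (u v : 'cV[R]_n) : R :=
  \sum_(i < n) u i 0 * v i 0.

Definition enorm (R : realType) (n : nat) (u : 'cV[R]_n) : R :=
  Num.sqrt (dotp u u).

Definition sphere (R : realType) (n : nat) : set 'cV[R]_n :=
  [set x | enorm x = 1].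
Arguments sphere : clear implicits.

Definition tproj (R : realType) (n : nat) (x : 'cV[R]_n) : 'M[R]_n :=
  1%:M - x *m x^T.

Definition borel_space (R : realType) (n : nat) :=
  g_sigma_algebraType (@open 'cV[R]_n).

(* A Borel probability measure on the sphere is encoded as a Borel probability
   measure on R^n that gives the sphere full mass. *)
Definition on_sphere (R : realType) (n : nat)
    (mu : probability (borel_space R n) R) : Prop :=
  mu (sphere R n) = 1%E.

Definition energy (R : realType) (n : nat) (D : 'M[R]_n)
    (mu : probability (borel_space R n) R) : R :=
  (\int[mu]_(y in sphere R n)
     \int[mu]_(x in sphere R n) expR (dotp x (D *m y)))%R.

Definition lipschitz_field (R : realType) (n : nat)
    (V : 'cV[R]_n -> 'cV[R]_n) : Prop :=
  exists L : R, forall x y, enorm (V x - V y) <= L * enorm (x - y).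

Definition grad (R : realType) (n : nat) (phi : 'cV[R]_n -> R)
    (x : 'cV[R]_n) : 'cV[R]_n :=
  \col_(i < n) 'D_(delta_mx i 0) phi x.

Definition C1 (R : realType) (n : nat) (phi : 'cV[R]_n -> R) : Prop :=
  (forall x, differentiable phi x) /\ continuous (grad phi).

(* Initial values are compared on Borel sets only: a measure is a function on
   all subsets, and its values off the sigma-algebra are meaningless. *)
Definition weak_solution (R : realType) (n : nat) (V : 'cV[R]_n -> 'cV[R]_n)
    (mu0 : probability (borel_space R n) R)
    (mu : R -> probability (borel_space R n) R) : Prop :=
  [/\ forall t, on_sphere (mu t),
      forall A : set (borel_space R n), measurable A -> mu 0 A = mu0 A
    & forall phi : 'cV[R]_n -> R, C1 phi -> forall t : R,
        is_derive t 1
          (fun s : R => (\int[mu s]_(x in sphere R n) phi x)%R)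
          (\int[mu t]_(x in sphere R n)
             dotp (tproj x *m grad phi x) (V x))%R].

(* The curve solving the continuity equation from mu exists and is unique when
   V is Lipschitz, so quantifying over all solutions designates that curve. *)
Definition is_first_variation (R : realType) (n : nat) (D : 'M[R]_n)
    (mu : probability (borel_space R n) R) (V : 'cV[R]_n -> 'cV[R]_n)
    (dE : R) : Prop :=
  forall mut : R -> probability (borel_space R n) R,
    weak_solution V mu mut ->
    is_derive (0 : R) 1 (fun t : R => energy D (mut t)) dE.

Definition stationary_point (R : realType) (n : nat) (D : 'M[R]_n)
    (mu : probability (borel_space R n) R) : Prop :=
  on_sphere mu /\
  forall V : 'cV[R]_n -> 'cV[R]_n,
    lipschitz_field V -> is_first_variation D mu V 0.

(* The library's eigenspaces consist of row vectors, for the action v *m D. *)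
Definition eigenvector (R : realType) (n : nat) (D : 'M[R]_n)
    (z : 'cV[R]_n) : Prop :=
  z != 0 /\ exists a : R, D *m z = a *: z.

Definition dirac_at (R : realType) (n : nat) (z : 'cV[R]_n) :
  probability (borel_space R n) R := @dirac _ (borel_space R n) z R.

(* Main.v *)
Require Import Defs.
From HB Require Import structures.
From mathcomp Require Import all_boot all_order all_algebra.
From mathcomp Require Import all_classical all_reals all_analysis.
From mathcomp Require Import measurable_realfun ring lra.

Set Implicit Arguments.
Unset Strict Implicit.
Unset Printing Implicit Defensive.

Import Order.TTheory GRing.Theory Num.Theory.
Import numFieldNormedType.Exports.

Local Open Scope classical_set_scope.
Local Open Scope ring_scope.

(** Let a = z . D z.  Both directions avoid the well-posedness theory of the
    continuity equation.

    If D z = a z, then along any weak solution mu_t starting at the Dirac mass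
    at z the mean m(t) of x . z satisfies m(0) = 1 and m'(0) = 0, because the
    gradient z of x . z is killed by the tangential projection at z
    ([mean_stationary]).  On the sphere 1 - x . z is half the squared distance
    from x to z, so the mean squared distance to z is o(t).  The kernel
    exp (x . D y) has no first order term at (z, z) along the sphere when z is
    an eigenvector, so it differs from exp a by at most
    C ((1 - x . z) + (1 - y . z))
    ([kernel_quadratic_at_eigenvector]).  Integrating twice, the energy of mu_t
    differs from exp a by at most 2 C (1 - m(t)) ([energy_near_eigenvector]),
    hence has derivative 0 at t = 0.  No description of mu_t is used.

    Conversely, let e be a unit vector orthogonal to z.  The linear field
    rotating the plane of z and e from z towards e is tangent to the sphere,
    and its flow moves z along the great circle cos t z + sin t e; the Dirac
    masses on this circle form an explicit weak solution
    ([weak_solution_great_circle]).  Along it the energy is the exponential of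
    a quadratic form whose derivative at 0 is 2 e . D z, so stationarity gives
    e . D z = 0 ([stationary_orthogonal]).  Taking for e the normalization of
    w = D z - a z, if w is nonzero, would give |w| = 0; hence D z = a z. *)

(** * Euclidean geometry of the sphere *)

Lemma dotpC (R : realType) (n : nat) (u v : 'cV[R]_n) : dotp u v = dotp v u.
Proof. by apply: eq_bigr => i _; rewrite mulrC. Qed.

Lemma dotpDl (R : realType) (n : nat) (u v w : 'cV[R]_n) :
  dotp (u + v) w = dotp u w + dotp v w.
Proof.
by rewrite /dotp -big_split; apply: eq_bigr => i _; rewrite mxE mulrDl.
Qed.

Lemma dotpZl (R : realType) (n : nat) (a : R) (u w : 'cV[R]_n) :
  dotp (a *: u) w = a * dotp u w.
Proof. by rewrite /dotp mulr_sumr; apply: eq_bigr => i _; rewrite mxE mulrA. Qed.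

Lemma dotpNl (R : realType) (n : nat) (u w : 'cV[R]_n) :
  dotp (- u) w = - dotp u w.
Proof. by rewrite -scaleN1r dotpZl mulN1r. Qed.

Lemma dotpBl (R : realType) (n : nat) (u v w : 'cV[R]_n) :
  dotp (u - v) w = dotp u w - dotp v w.
Proof. by rewrite dotpDl dotpNl. Qed.

Lemma dotpDr (R : realType) (n : nat) (u v w : 'cV[R]_n) :
  dotp u (v + w) = dotp u v + dotp u w.
Proof. by rewrite dotpC dotpDl !(dotpC u). Qed.

Lemma dotpZr (R : realType) (n : nat) (a : R) (u w : 'cV[R]_n) :
  dotp u (a *: w) = a * dotp u w.
Proof. by rewrite dotpC dotpZl dotpC. Qed.

Lemma dotpNr (R : realType) (n : nat) (u w : 'cV[R]_n) :
  dotp u (- w) = - dotp u w.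
Proof. by rewrite dotpC dotpNl dotpC. Qed.

Lemma dotpBr (R : realType) (n : nat) (u v w : 'cV[R]_n) :
  dotp u (v - w) = dotp u v - dotp u w.
Proof. by rewrite dotpDr dotpNr. Qed.

Definition dotpE := (dotpDl, dotpDr, dotpNl, dotpNr, dotpZl, dotpZr).

Lemma dotp_mxE (R : realType) (n : nat) (u v : 'cV[R]_n) :
  dotp u v = (u^T *m v) 0 0.
Proof. by rewrite mxE; apply: eq_bigr => i _; rewrite mxE. Qed.

Lemma dotp_sym_mx (R : realType) (n : nat) (D : 'M[R]_n) (u v : 'cV[R]_n) :
  D^T = D -> dotp u (D *m v) = dotp v (D *m u).
Proof.
move=> hD; by rewrite dotpC !dotp_mxE trmx_mul hD -mulmxA.
Qed.

Lemma dotp_ge0 (R : realType) (n : nat) (u : 'cV[R]_n) : 0 <= dotp u u.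
Proof. by apply: sumr_ge0 => i _; rewrite -expr2 sqr_ge0. Qed.

Lemma dotp_eq0 (R : realType) (n : nat) (u : 'cV[R]_n) :
  dotp u u = 0 -> u = 0.
Proof.
move=> /psumr_eq0P u0; apply/matrixP => i j; rewrite ord1 mxE.
have /eqP := u0 (fun i _ => ltac:(by rewrite -expr2 sqr_ge0)) i isT.
by rewrite mulf_eq0 orbb => /eqP.
Qed.

Lemma sphereP (R : realType) (n : nat) (x : 'cV[R]_n) :
  sphere R n x <-> dotp x x = 1.
Proof.
rewrite /sphere /= /enorm; split => [h|->]; last exact: sqrtr1.
by rewrite -[LHS]sqr_sqrtr ?dotp_ge0// h expr1n.
Qed.

Lemma dotp_tproj (R : realType) (n : nat) (x g v : 'cV[R]_n) :
  dotp (tproj x *m g) v = dotp g v - dotp x g * dotp x v.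
Proof.
rewrite /tproj mulmxBl mul1mx dotpBl; congr (_ - _).
rewrite -mulmxA [x^T *m g]mx11_scalar mul_mx_scalar dotpZl; congr (_ * _).
by rewrite dotp_mxE.
Qed.

(** A crude operator bound by the sum of the absolute values of the entries is
    enough here: only the finiteness of the constant matters. *)
Definition entry_sum (R : realType) (n : nat) (D : 'M[R]_n) : R :=
  \sum_(i < n) \sum_(j < n) `|D i j|.

Lemma entry_sum_ge0 (R : realType) (n : nat) (D : 'M[R]_n) : 0 <= entry_sum D.
Proof. by do 2 apply: sumr_ge0 => ? _. Qed.

Lemma sqr_coord_le (R : realType) (n : nat) (u : 'cV[R]_n) (i : 'I_n) :
  u i 0 ^+ 2 <= dotp u u.
Proof.
rewrite /dotp (bigD1 i)//= -expr2 lerDl.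
by apply: sumr_ge0 => j _; rewrite -expr2 sqr_ge0.
Qed.

Lemma dotp_mx_le (R : realType) (n : nat) (D : 'M[R]_n) (u v : 'cV[R]_n) :
  `|dotp u (D *m v)| <= entry_sum D * (dotp u u + dotp v v).
Proof.
rewrite /dotp /entry_sum mulr_suml (le_trans (ler_norm_sum _ _ _))//.
apply: ler_sum => i _; rewrite -!/(dotp _ _) mxE mulr_sumr mulr_suml.
rewrite (le_trans (ler_norm_sum _ _ _))//; apply: ler_sum => j _.
rewrite mulrCA normrM ler_wpM2l// normrM.
have := sqr_coord_le u i; have := sqr_coord_le v j.
rewrite -[u i 0 ^+ 2]real_normK ?num_real// -[v j 0 ^+ 2]real_normK ?num_real//.
by have := sqr_ge0 (`|u i 0| - `|v j 0|); nra.
Qed.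

(** Since 1 + r <= exp r for r = t - s, the increment exp s - exp t is at most
    exp s times s - t when t <= s. *)
Lemma expR_lipschitz_le (R : realType) (M s t : R) : s <= M -> t <= M ->
  `|expR s - expR t| <= expR M * `|s - t|.
Proof.
wlog ts : s t / t <= s.
  move=> H sM tM; have [/H|/ltW/H] := leP t s; first exact.
  by rewrite distrC (distrC s); exact.
move=> sM tM; rewrite !ger0_norm ?subr_ge0 ?ler_expR//.
have -> : expR s - expR t = expR s * (1 - expR (t - s)).
  by rewrite mulrBr mulr1 -expRD [s + _]addrC subrK.
apply: (@le_trans _ _ (expR s * (s - t))).
  by rewrite ler_wpM2l ?expR_ge0//; have := expR_ge1Dx (t - s); lra.
by rewrite ler_wpM2r ?subr_ge0// ler_expR.
Qed.

(** Writing x = z + u and y = z + v, the terms of x . D y that are linear in u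
    and v are multiples of u . z and v . z since D z = a z, and on the sphere
    u . z = - |u|^2 / 2.  So the kernel differs from its value at (z, z) by a
    quadratic quantity, and |u|^2 = 2 (1 - x . z). *)
Lemma kernel_quadratic_at_eigenvector (R : realType) (n : nat) (D : 'M[R]_n)
    (z : 'cV[R]_n) (hD : D^T = D) (hz : sphere R n z) (hev : eigenvector D z) :
  exists2 C : R, 0 <= C & forall x y, sphere R n x -> sphere R n y ->
    `|expR (dotp x (D *m y)) - expR (dotp z (D *m z))|
      <= C * ((1 - dotp x z) + (1 - dotp y z)).
Proof.
move: hev => [_ [a Dz]]; have K0 := entry_sum_ge0 D; set K := entry_sum D in K0 *.
exists (expR (2 * K) * (4 * K)); first by rewrite mulr_ge0 ?expR_ge0// mulr_ge0.
move=> x y /sphereP xx /sphereP yy; move/sphereP : hz => zz.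
(* An a priori bound on the exponents, used as the cutoff M in the Lipschitz
   bound of exp and again for the eigenvalue a. *)
have le2K u v : dotp u u = 1 -> dotp v v = 1 -> `|dotp u (D *m v)| <= 2 * K.
  move=> uu vv; have := dotp_mx_le D u v.
  by rewrite uu vv -/K (_ : 1 + 1 = 2)// mulrC.
apply: le_trans (expR_lipschitz_le _ _) _.
- exact: le_trans (ler_norm _) (le2K _ _ xx yy).
- exact: le_trans (ler_norm _) (le2K _ _ zz zz).
rewrite -mulrA ler_wpM2l ?expR_ge0//.
have zDz : dotp z (D *m z) = a by rewrite Dz dotpZr zz mulr1.
have := le2K z z zz zz; rewrite zDz => aK.
have := dotp_mx_le D (x - z) (y - z); rewrite -/K.
(* The mixed term of the expansion; symmetry of D makes both linear terms
   multiples of a. *)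
have -> : dotp (x - z) (D *m (y - z)) =
    dotp x (D *m y) - a - a * (dotp x z - 1) - a * (dotp y z - 1).
  rewrite mulmxBr dotpBl !dotpBr (dotp_sym_mx z y hD) Dz !dotpZr zz.
  by ring.
rewrite !dotpE !(dotpC z) xx yy zz.
set p := dotp x z; set q := dotp y z; set w := dotp x _.
have p1 : p <= 1.
  by have := dotp_ge0 (x - z); rewrite !dotpE !(dotpC z) xx zz -/p; lra.
have q1 : q <= 1.
  by have := dotp_ge0 (y - z); rewrite !dotpE !(dotpC z) yy zz -/q; lra.
move: aK; rewrite !ler_norml => /andP[? ?] /andP[? ?].
by apply/andP; split; nra.
Qed.

(** * Continuity and measurability *)

Lemma continuous_dotp (R : realType) (n : nat) (T : topologicalType)
    (f g : T -> 'cV[R]_n) :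
  (forall i, continuous (fun x => f x i 0)) ->
  (forall i, continuous (fun x => g x i 0)) ->
  continuous (fun x => dotp (f x) (g x)).
Proof.
move=> cf cg; rewrite /dotp; apply: continuous_big => [|i _ x].
  exact: add_continuous.
by apply: cvgM; [exact: cf|exact: cg].
Qed.

Lemma continuous_dotpl (R : realType) (n : nat) (w : 'cV[R]_n) :
  continuous (fun x => dotp x w).
Proof.
apply: continuous_dotp => i; first exact: coord_continuous.
by move=> x; exact: (@cst_continuous _ _ (w i 0) x).
Qed.

(** The Borel sigma-algebra of R^n is generated by its open sets, so the
    preimages of open intervals are generators. *)
Lemma continuous_measurable (R : realType) (n : nat) (f : 'cV[R]_n -> R)
    (A : set (borel_space R n)) :
  continuous f -> measurable_fun A (f : borel_space R n -> R).
Proof.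
move=> /continuousP cf; apply: (@measurable_funS _ _ _ _ setT) => //.
apply: (measurability _ (RGenOpens.measurableE R)).
move=> _ [_ [a [b ->] <-]]; rewrite setTI; apply: sub_sigma_algebra.
exact/cf/interval_open.
Qed.

Lemma measurable_sphere (R : realType) (n : nat) :
  measurable (sphere R n : set (borel_space R n)).
Proof.
have -> : sphere R n = (fun x => dotp x x) @^-1` [set 1].
  by apply/seteqP; split => x /sphereP.
rewrite -[X in measurable X]setTI; apply: (@continuous_measurable R n) => //.
by apply: continuous_dotp => i; exact: coord_continuous.
Qed.

(** * Integrals over the sphere *)

Lemma integrable_sphere (R : realType) (n : nat)
    (P : probability (borel_space R n) R) (f : borel_space R n -> R) (M : R) :
  measurable_fun (sphere R n : set (borel_space R n)) f ->
  (forall x, sphere R n x -> `|f x| <= M) ->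
  P.-integrable (sphere R n) (EFin \o f).
Proof.
move=> mf fM; apply: measurable_bounded_integrable => //.
- exact: measurable_sphere.
- by rewrite (le_lt_trans (probability_le1 _ (@measurable_sphere R n)))// ltry.
- exists M; split; first exact: num_real.
  by move=> y My x Sx; apply: le_trans (fM _ Sx) (ltW My).
Qed.

Lemma Rintegral_cst_sphere (R : realType) (n : nat)
    (P : probability (borel_space R n) R) (c : R) :
  on_sphere P -> (\int[P]_(x in sphere R n) c)%R = c.
Proof.
move=> PS; rewrite (Rintegral_cst _ (@measurable_sphere R n)).
rewrite -[RHS]mulr1; congr (_ * _).
by rewrite -[RHS]/(fine 1%:E); congr fine; exact: PS.
Qed.

(** A probability measure on the sphere fixes constants, so the constant can be
    moved under the integral. *)
Lemma Rintegral_dist_le (R : realType) (n : nat)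
    (P : probability (borel_space R n) R) (f k : borel_space R n -> R) (c : R) :
  on_sphere P ->
  P.-integrable (sphere R n) (EFin \o f) ->
  P.-integrable (sphere R n) (EFin \o k) ->
  (forall x, sphere R n x -> `|f x - c| <= k x) ->
  `|(\int[P]_(x in sphere R n) f x)%R - c| <= (\int[P]_(x in sphere R n) k x)%R.
Proof.
move=> PS If Ik fk; have mS := @measurable_sphere R n.
have Ic : P.-integrable (sphere R n) (EFin \o (cst c : borel_space R n -> R)).
  by apply: (@integrable_sphere _ _ _ _ (`|c|)).
rewrite -{1}(Rintegral_cst_sphere c PS) -RintegralB//.
have Ifc : P.-integrable (sphere R n) (EFin \o (fun x => f x - c)).
  by have := integrableB mS If Ic.
apply: le_trans (le_normr_Rintegral mS Ifc) _.
by apply: le_Rintegral => //; exact: integrable_norm.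
Qed.

Lemma dotp_sphere_le1 (R : realType) (n : nat) (x z : 'cV[R]_n) :
  sphere R n x -> sphere R n z -> `|dotp x z| <= 1.
Proof.
move=> /sphereP xx /sphereP zz; rewrite ler_norml.
have := dotp_ge0 (x - z); have := dotp_ge0 (x + z).
by rewrite !dotpE !(dotpC z) xx zz => ? ?; apply/andP; split; lra.
Qed.

Lemma integrable_dotp (R : realType) (n : nat)
    (P : probability (borel_space R n) R) (z : 'cV[R]_n) : sphere R n z ->
  P.-integrable (sphere R n) (EFin \o (fun x : borel_space R n => dotp x z)).
Proof.
move=> hz; apply: (@integrable_sphere _ _ _ _ 1) => [|x Sx].
  by apply: continuous_measurable; exact: continuous_dotpl.
exact: dotp_sphere_le1.
Qed.

Lemma Rintegral_affine (R : realType) (n : nat)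
    (P : probability (borel_space R n) R) (z : 'cV[R]_n) (a b : R) :
  sphere R n z -> on_sphere P ->
  P.-integrable (sphere R n)
    (EFin \o (fun x : borel_space R n => a + b * dotp x z)) /\
  (\int[P]_(x in sphere R n) (a + b * dotp x z))%R =
    a + b * (\int[P]_(x in sphere R n) dotp x z)%R.
Proof.
move=> hz PS; have mS := @measurable_sphere R n; have Id := integrable_dotp P hz.
have Ia : P.-integrable (sphere R n) (EFin \o (cst a : borel_space R n -> R)).
  by apply: (@integrable_sphere _ _ _ _ (`|a|)).
have Ib : P.-integrable (sphere R n)
    (EFin \o (fun x : borel_space R n => b * dotp x z)).
  by have := integrableZl mS b Id.
split; first by have := integrableD mS Ia Ib.
by rewrite (RintegralD mS Ia Ib) (RintegralZl b mS Id) Rintegral_cst_sphere.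
Qed.

(** The integrand is jointly measurable in (x, y) as a function of finitely many
    coordinates, so Tonelli gives measurability of the partial integral. *)
Lemma measurable_potential (R : realType) (n : nat) (D : 'M[R]_n)
    (P : probability (borel_space R n) R) :
  measurable_fun setT (fun y : borel_space R n =>
    (\int[P]_(x in sphere R n) expR (dotp x (D *m y)))%R).
Proof.
have mS := @measurable_sphere R n.
pose T : measurableType _ := borel_space R n.
pose k : T * T -> \bar R :=
  (fun p : T * T => (expR (dotp p.2 (D *m p.1)))%:E)
    \_ ([set: T] `*` (sphere R n : set T)).
have mco i : measurable_fun setT (fun x : borel_space R n => (x : 'cV[R]_n) i 0).
  by apply: (@continuous_measurable R n (fun x => x i 0)); exact: coord_continuous.
have mk : measurable_fun setT k.
  apply: (measurable_restrictT _ (measurableX measurableT mS)).1.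
  apply: measurable_funTS; apply/measurable_EFinP.
  apply: (measurableT_comp (@measurable_expR R)); apply: measurable_sum => i.
  apply: measurable_funM; first exact: measurableT_comp (mco i) measurable_snd.
  under eq_fun do rewrite mxE; apply: measurable_sum => j.
  apply: measurable_funM => //; exact: measurableT_comp (mco j) measurable_fst.
have k0 p : (0 <= k p)%E.
  by rewrite /k/patch; case: ifP => // _; rewrite lee_fin expR_ge0.
have := @measurable_fun_fubini_tonelli_F _ _ _ _ _ P k mk k0.
move=> mF; apply: measurableT_comp => //.
apply: eq_measurable_fun mF => y _; rewrite /fubini_F [RHS]integral_mkcond.
apply: eq_integral => x _; rewrite /k /patch.
suff -> : ((y, x) \in ([set: T] `*` (sphere R n : set T)))
  = (x \in sphere R n) by [].
by apply/idP/idP; rewrite !inE/= => -[].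
Qed.

(** The kernel bound integrated in x and in y: each of its two terms
    contributes C (1 - m), where m is the mean of x . z. *)
Lemma energy_near_eigenvector (R : realType) (n : nat) (D : 'M[R]_n)
    (z : 'cV[R]_n) (hD : D^T = D) (hz : sphere R n z) (hev : eigenvector D z) :
  exists2 C : R, 0 <= C & forall P : probability (borel_space R n) R,
    on_sphere P ->
    `|energy D P - expR (dotp z (D *m z))|
      <= C * (1 - (\int[P]_(x in sphere R n) dotp x z)%R).
Proof.
have [C C0 hC] := kernel_quadratic_at_eigenvector hD hz hev.
exists (2 * C); first by rewrite mulr_ge0.
move=> P PS; have mS := @measurable_sphere R n.
set c := expR _ in hC *; set m := (\int[P]_(x in sphere R n) dotp x z)%R.
(* The kernel bound is affine in x . z, so that its integral only involves the
   mean m. *)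
have aff y : C * ((1 - m) + (1 - dotp y z)) =
    (\int[P]_(x in sphere R n) (C * (2 - dotp y z) + (- C) * dotp x z))%R.
  by rewrite (Rintegral_affine _ _ hz PS).2 -/m; ring.
have pot y : sphere R n y ->
    `|(\int[P]_(x in sphere R n) expR (dotp x (D *m y)))%R - c|
      <= C * ((1 - m) + (1 - dotp y z)).
  move=> Sy; rewrite aff; apply: Rintegral_dist_le => //.
  - apply: (@integrable_sphere _ _ _ _ (`|c| + C * 4)).
      apply: (@continuous_measurable R n (fun x => expR (dotp x (D *m y)))) => x.
      apply: (@continuous_comp _ _ _ (fun x => dotp x (D *m y)) expR).
        exact: continuous_dotpl.
      exact: continuous_expR.
    move=> x Sx; rewrite -(subrKC c (expR _)) (le_trans (ler_normD _ _))// lerD2l.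
    apply: le_trans (hC _ _ Sx Sy) _; rewrite ler_wpM2l//.
    have := dotp_sphere_le1 Sx hz; have := dotp_sphere_le1 Sy hz.
    by rewrite !ler_norml => /andP[? ?] /andP[? ?]; lra.
  - exact: (Rintegral_affine _ _ hz PS).1.
  - by move=> x Sx; apply: le_trans (hC _ _ Sx Sy) _; nra.
rewrite (_ : 2 * C * _ =
    (\int[P]_(y in sphere R n) (C * (2 - m) + (- C) * dotp y z))%R); last first.
  by rewrite (Rintegral_affine _ _ hz PS).2 -/m; ring.
apply: Rintegral_dist_le => //.
- apply: (@integrable_sphere _ _ _ _ (`|c| + C * (`|1 - m| + 2))).
    by apply: measurable_funTS; exact: measurable_potential.
  move=> y Sy; rewrite -(subrKC c (Rintegral _ _ _)).
  rewrite (le_trans (ler_normD _ _))// lerD2l.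
  apply: le_trans (pot _ Sy) _; rewrite ler_wpM2l// lerD ?ler_norm//.
  by have := dotp_sphere_le1 Sy hz; rewrite !ler_norml => /andP[? ?]; lra.
- exact: (Rintegral_affine _ _ hz PS).1.
- by move=> y Sy; apply: le_trans (pot _ Sy) _; nra.
Qed.

(** Agreement with the Dirac mass is asked on Borel sets only, since this is what
    the initial condition of a weak solution provides. *)
Lemma Rintegral_dirac (R : realType) (n : nat) (z : 'cV[R]_n)
    (P : probability (borel_space R n) R) (f : 'cV[R]_n -> R) :
  sphere R n z ->
  (forall A : set (borel_space R n), measurable A -> P A = dirac_at z A) ->
  continuous f -> (\int[P]_(x in sphere R n) f x)%R = f z.
Proof.
move=> hz Pz cf; have mS := @measurable_sphere R n.
rewrite /Rintegral (@eq_measure_integral _ _ _ _ (dirac_at z)); last first.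
  by move=> A mA _; exact: Pz.
rewrite integral_dirac//; last first.
  by apply/measurable_EFinP; exact: continuous_measurable.
by rewrite diracE mem_set// mul1e.
Qed.

Lemma energy_dirac (R : realType) (n : nat) (D : 'M[R]_n) (z : 'cV[R]_n) :
  D^T = D -> sphere R n z ->
  energy D (dirac_at z) = expR (dotp z (D *m z)).
Proof.
move=> hD hz; rewrite /energy.
transitivity (\int[dirac_at z]_(y in sphere R n) expR (dotp y (D *m z)))%R.
  apply: eq_Rintegral => y _.
  rewrite (@Rintegral_dirac _ _ z _ (fun x => expR (dotp x (D *m y))))//.
    by rewrite dotp_sym_mx.
  move=> x; apply: (@continuous_comp _ _ _ (fun x => dotp x (D *m y)) expR).
    exact: continuous_dotpl.
  exact: continuous_expR.
rewrite (@Rintegral_dirac _ _ z _ (fun x => expR (dotp x (D *m z))))//.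
move=> x; apply: (@continuous_comp _ _ _ (fun x => dotp x (D *m z)) expR).
  exact: continuous_dotpl.
exact: continuous_expR.
Qed.

Lemma dirac_on_sphere (R : realType) (n : nat) (z : 'cV[R]_n) :
  sphere R n z -> on_sphere (dirac_at z).
Proof. by move=> hz; rewrite /on_sphere /dirac_at /= diracE mem_set. Qed.

(** * Differentiation *)

(** The difference quotients of F are squeezed by C times those of G. *)
Lemma is_derive0_squeeze (R : realType) (F G : R -> R) (C : R) :
  (forall t, `|F t - F 0| <= C * `|G t - G 0|) ->
  is_derive (0 : R) 1 G 0 -> is_derive (0 : R) 1 F 0.
Proof.
move=> FG [dG G0].
have cG : (h^-1 *: ((G \o shift 0) (h *: 1) - G 0)) @[h --> 0^'] --> (0 : R).
  by rewrite -[X in _ --> X]G0.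
suff cF : (h^-1 *: ((F \o shift 0) (h *: 1) - F 0)) @[h --> 0^'] --> (0 : R).
  by apply: DeriveDef; [apply/cvg_ex; exists 0 | exact: cvg_lim cF].
apply: norm_cvg0.
have cCG : (C * `|h^-1 *: ((G \o shift 0) (h *: 1) - G 0)|) @[h --> 0^'] --> (0 : R).
  have := cvg_norm cG; rewrite normr0 => cn.
  by rewrite -[X in _ --> X](mulr0 C); apply: cvgM; [exact: cvg_cst|exact: cn].
refine (squeeze_cvgr (f := cst 0) _ (cvg_cst _) cCG).
by apply: nearW => h /=; rewrite normr_ge0 /= !normrM mulrCA ler_wpM2l//.
Qed.

Lemma derive_grad (R : realType) (n : nat) (phi : 'cV[R]_n -> R) (x v : 'cV[R]_n) :
  differentiable phi x -> 'd phi x v = dotp (grad phi x) v.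
Proof.
move=> dphi; rewrite {1}[v]matrix_sum_delta linear_sum /dotp.
apply: eq_bigr => i _; rewrite big_ord1 linearZ /= mxE mulrC.
by rewrite deriveE.
Qed.

Lemma C1_dotp (R : realType) (n : nat) (z : 'cV[R]_n) :
  C1 (fun x => dotp x z) /\ (forall x, grad (fun x => dotp x z) x = z).
Proof.
have lin : linear (fun x : 'cV[R]_n => dotp x z : R).
  by move=> a u v; rewrite dotpDl dotpZl.
pose glM := GRing.isLinear.Build _ _ _ _ _ lin.
pose L : {linear 'cV[R]_n -> R} := HB.pack (fun x : 'cV[R]_n => dotp x z : R) glM.
have cL : continuous L by exact: continuous_dotpl.
have dL x : differentiable (fun x => dotp x z) x.
  exact: (linear_differentiable (f := L)).
have gz x : grad (fun x => dotp x z) x = z.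
  apply/matrixP => i j; rewrite ord1 mxE deriveE//.
  rewrite (diff_lin (f := L) x cL) /= /dotp (bigD1 i)//= mxE !eqxx mul1r.
  rewrite big1 ?addr0// => k ki; rewrite mxE (negbTE ki) mul0r//.
split => //; split => //.
by rewrite (_ : grad _ = cst z); [exact: cst_continuous|exact/funext].
Qed.

Lemma coord_lipschitz_field (R : realType) (n : nat)
    (V : 'cV[R]_n -> 'cV[R]_n) (i : 'I_n) :
  lipschitz_field V -> continuous (fun x => V x i 0).
Proof.
move=> [L VL] x.
suff cV : `|V y i 0 - V x i 0| @[y --> x] --> (0 : R).
  have cV0 : (V y i 0 - V x i 0) @[y --> x] --> (0 : R) by exact: norm_cvg0 cV.
  by move/subr_cvg0 : cV0.
have cB j : continuous (fun y : 'cV[R]_n => (y - x) j 0).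
  rewrite (_ : (fun y => _) = fun y : 'cV[R]_n => y j 0 - x j 0).
    move=> y; apply: (@continuousB _ _ _ (fun y : 'cV[R]_n => y j 0)).
      exact: coord_continuous.
    exact: (@cst_continuous _ _ (x j 0)).
  by apply/funext => y; rewrite !mxE.
have cE : continuous (fun y : 'cV[R]_n => L * enorm (y - x)).
  move=> y; apply: (@continuous_comp _ _ _
    (fun y : 'cV[R]_n => enorm (y - x) : R) (fun r : R => L * r)).
    apply: (@continuous_comp _ _ _
      (fun y : 'cV[R]_n => dotp (y - x) (y - x)) Num.sqrt).
      exact: continuous_dotp.
    exact: sqrt_continuous.
  exact: mulrl_continuous.
have Ex : L * enorm (x - x) = 0.
  rewrite subrr /enorm /dotp big1 ?sqrtr0 ?mulr0// => j _.
  by rewrite mxE mul0r.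
have := cE x; rewrite /continuous_at Ex => cN.
refine (squeeze_cvgr (f := cst 0) _ (cvg_cst _) cN).
apply: nearW => y; rewrite normr_ge0 /=; apply: le_trans (VL y x).
rewrite -(sqrtr_sqr (_ - _)) ler_wsqrtr//.
by have := sqr_coord_le (V y - V x) i; rewrite !mxE.
Qed.

(** The integrand of the weak continuity equation is continuous, so its integral
    against a Dirac mass is its value at the atom. *)
Lemma continuous_tproj_dotp (R : realType) (n : nat) (phi : 'cV[R]_n -> R)
    (V : 'cV[R]_n -> 'cV[R]_n) : C1 phi -> lipschitz_field V ->
  continuous (fun x => dotp (tproj x *m grad phi x) (V x)).
Proof.
move=> [_ cg] lV.
have cV i : continuous (fun x => V x i 0) by exact: coord_lipschitz_field.
have cG i : continuous (fun x => grad phi x i 0).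
  move=> x; apply: (@continuous_comp _ _ _ (grad phi) (fun y => y i 0)).
    exact: cg.
  exact: coord_continuous.
have cX i : continuous (fun x : 'cV[R]_n => x i 0) by exact: coord_continuous.
rewrite (_ : (fun x => _) = fun x =>
    dotp (grad phi x) (V x) - dotp x (grad phi x) * dotp x (V x)).
  have := (continuous_dotp cG cV, continuous_dotp cX cG, continuous_dotp cX cV).
  move=> [[gV xg] xV] x.
  apply: (@continuousB _ _ _ (fun x => dotp (grad phi x) (V x))); first exact: gV.
  by apply: (@continuousM _ _ (fun x => dotp x (grad phi x))); [exact: xg|exact: xV].
by apply/funext => x; rewrite dotp_tproj.
Qed.

(** The weak equation for the test function x . z has right-hand side
    P_z z . V(z) at t = 0, and P_z z = 0. *)
Lemma mean_stationary (R : realType) (n : nat) (z : 'cV[R]_n)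
    (V : 'cV[R]_n -> 'cV[R]_n) (mut : R -> probability (borel_space R n) R) :
  sphere R n z -> lipschitz_field V -> weak_solution V (dirac_at z) mut ->
  is_derive (0 : R) 1 (fun t => (\int[mut t]_(x in sphere R n) dotp x z)%R) 0.
Proof.
move=> hz lV [_ mu0 /(_ _ (C1_dotp z).1 0)].
rewrite (Rintegral_dirac hz mu0 (continuous_tproj_dotp (C1_dotp z).1 lV)).
rewrite (C1_dotp z).2 dotp_tproj.
by move/sphereP : hz => ->; rewrite mul1r subrr.
Qed.

(** The energy moves by at most a constant times the change of the mean of
    x . z, whose derivative vanishes. *)
Lemma eigenvector_stationary (R : realType) (n : nat) (D : 'M[R]_n)
    (z : 'cV[R]_n) :
  D^T = D -> sphere R n z -> eigenvector D z -> stationary_point D (dirac_at z).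
Proof.
move=> hD hz hev; split; first exact: dirac_on_sphere.
move=> V lV mut sol; have [C C0 hC] := energy_near_eigenvector hD hz hev.
have [onS mu0 _] := sol.
set m := fun t => (\int[mut t]_(x in sphere R n) dotp x z)%R.
have m0 : m 0 = 1.
  by rewrite /m (Rintegral_dirac hz mu0 (@continuous_dotpl _ _ z)); apply/sphereP.
have E0 : energy D (mut 0) = expR (dotp z (D *m z)).
  have := hC _ (onS 0); rewrite -/(m 0) m0 subrr mulr0 normr_le0 subr_eq0.
  by move/eqP.
apply: (@is_derive0_squeeze _ _ m C) (mean_stationary hz lV sol) => t.
rewrite E0 m0 (le_trans (hC _ (onS t)))// ler_wpM2l// -/(m t).
by rewrite distrC ler_norm.
Qed.

(** * The rotation flow *)

(** The infinitesimal generator of the rotations of the plane of z and e, for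
    orthonormal z and e, extended by 0 to the orthogonal complement. *)
Definition rotation_field (R : realType) (n : nat) (z e x : 'cV[R]_n) : 'cV[R]_n :=
  dotp x z *: e - dotp x e *: z.

Definition great_circle (R : realType) (n : nat) (z e : 'cV[R]_n) (t : R) :
    'cV[R]_n :=
  cos t *: z + sin t *: e.

(** The field is linear, and its norm at h is the norm of the orthogonal
    projection of h to the plane of z and e: by Bessel it is 1-Lipschitz. *)
Lemma lipschitz_rotation_field (R : realType) (n : nat) (z e : 'cV[R]_n) :
  sphere R n z -> sphere R n e -> dotp e z = 0 ->
  lipschitz_field (rotation_field z e).
Proof.
move=> /sphereP zz /sphereP ee ez; exists 1 => x y.
rewrite mul1r /enorm ler_wsqrtr//.
have -> : rotation_field z e x - rotation_field z e y = rotation_field z e (x - y).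
  rewrite /rotation_field !dotpBl !scalerBl.
  by apply/matrixP => i j; rewrite !mxE; ring.
move: (x - y) => h; rewrite /rotation_field.
(* Bessel's inequality: the residual of the projection has nonnegative norm. *)
have := dotp_ge0 (h - dotp h z *: z - dotp h e *: e).
rewrite !dotpE (dotpC z e) !(dotpC z h) !(dotpC e h) zz ee ez.
set a := dotp h z; set b := dotp h e; set c := dotp h h => H.
by lra.
Qed.

Lemma great_circle_on_sphere (R : realType) (n : nat) (z e : 'cV[R]_n) (t : R) :
  sphere R n z -> sphere R n e -> dotp e z = 0 ->
  sphere R n (great_circle z e t).
Proof.
move=> /sphereP zz /sphereP ee ez; apply/sphereP; rewrite /great_circle.
rewrite !dotpE (dotpC z e) zz ee ez.
by have := cos2Dsin2 t; lra.
Qed.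

(** Chain rule: the velocity of the circle at time t is the rotation field at
    the point reached. *)
Lemma is_derive_great_circle (R : realType) (n : nat) (z e : 'cV[R]_n)
    (phi : 'cV[R]_n -> R) (t : R) :
  sphere R n z -> sphere R n e -> dotp e z = 0 ->
  differentiable phi (great_circle z e t) ->
  is_derive t 1 (phi \o great_circle z e)
    (dotp (grad phi (great_circle z e t))
       (rotation_field z e (great_circle z e t))).
Proof.
move=> /sphereP zz /sphereP ee ez dphi.
have dc : differentiable (@cos R) t by apply/derivable1_diffP.
have ds : differentiable (@sin R) t by apply/derivable1_diffP.
have dx : differentiable (great_circle z e) t.
  by apply: differentiableD; exact: differentiableZl.
have dpx : differentiable (phi \o great_circle z e) t.
  exact: differentiable_comp.
apply: DeriveDef; first exact/derivable1_diffP.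
rewrite deriveE// diff_comp//= derive_grad//; congr dotp.
have dcz : 'd (fun s => cos s *: z) t 1 = - sin t *: z.
  by rewrite (diffZl z dc) -deriveE// derive_val.
have dse : 'd (fun s => sin s *: e) t 1 = cos t *: e.
  by rewrite (diffZl e ds) -deriveE// derive_val.
rewrite (_ : 'd (great_circle z e) t 1 = - sin t *: z + cos t *: e); last first.
  by rewrite (diffD (differentiableZl z dc) (differentiableZl e ds)) -dcz -dse.
rewrite /rotation_field /great_circle !dotpE (dotpC z e) zz ee ez.
by rewrite !mulr0 !mulr1 addr0 add0r scaleNr addrC.
Qed.

(** The rotation field is orthogonal to the position, so the tangential
    projection does not change its pairing with the gradient, and the weak
    equation is the chain rule along the circle. *)
Lemma weak_solution_great_circle (R : realType) (n : nat) (z e : 'cV[R]_n) :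
  sphere R n z -> sphere R n e -> dotp e z = 0 ->
  weak_solution (rotation_field z e) (dirac_at z)
    (fun t => dirac_at (great_circle z e t)).
Proof.
move=> hz he ez; split.
- by move=> t; exact/dirac_on_sphere/great_circle_on_sphere.
- by move=> A _; rewrite /great_circle cos0 sin0 scale1r scale0r addr0.
- move=> phi Cphi t; have cphi : continuous phi.
    by move=> x; exact/differentiable_continuous/Cphi.1.
  have S s := great_circle_on_sphere s hz he ez.
  have lV := lipschitz_rotation_field hz he ez.
  rewrite (Rintegral_dirac (S t) _ (continuous_tproj_dotp Cphi lV))//.
  rewrite (_ : (fun s => _) = phi \o great_circle z e); last first.
    by apply/funext => s; rewrite (Rintegral_dirac (S s) _ cphi).
  have := is_derive_great_circle hz he ez (Cphi.1 (great_circle z e t)).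
  rewrite dotp_tproj.
  have tangent x : dotp x (rotation_field z e x) = 0.
    by rewrite /rotation_field dotpBr !dotpZr mulrC subrr.
  rewrite tangent.
  by rewrite mulr0 subr0.
Qed.

(** Stationarity tested with the rotation from z towards e. *)
Lemma stationary_orthogonal (R : realType) (n : nat) (D : 'M[R]_n)
    (z e : 'cV[R]_n) :
  D^T = D -> sphere R n z -> stationary_point D (dirac_at z) ->
  sphere R n e -> dotp e z = 0 -> dotp e (D *m z) = 0.
Proof.
move=> hD hz [_ st] he ez.
have := st _ (lipschitz_rotation_field hz he ez) _
  (weak_solution_great_circle hz he ez).
set a := dotp z (D *m z); set b := dotp e (D *m z); set d := dotp e (D *m e).
(* q t is x . D x at x = cos t z + sin t e. *)
pose q : R -> R := a *: (@cos R * @cos R) + (2 * b) *: (@cos R * @sin R)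
  + d *: (@sin R * @sin R).
rewrite (_ : (fun t => _) = expR \o q); last first.
  apply/funext => t; rewrite energy_dirac//; last exact: great_circle_on_sphere.
  congr expR; rewrite /great_circle mulmxDr -!scalemxAr !dotpE.
  rewrite (dotp_sym_mx z e hD) -/a -/b -/d.
  rewrite -[RHS]/(a * (cos t * cos t) + 2 * b * (cos t * sin t)
    + d * (sin t * sin t)).
  by ring.
move=> [_ E0].
have : is_derive (0 : R) 1 (expR \o q) (expR (q 0) * (2 * b)).
  apply: is_derive1_comp; rewrite /q; apply: is_derive_eq.
  rewrite cos0 sin0 /GRing.scale /=.
  by ring.
move=> [_]; rewrite E0 => /esym/eqP.
by rewrite !mulf_eq0 gt_eqF ?expR_gt0//= pnatr_eq0/= => /eqP.
Qed.

Theorem lemma4p5 (R : realType) (n : nat) (D : 'M[R]_n) (z : 'cV[R]_n)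
    (hD : trmx D = D) (hz : sphere R n z) :
  stationary_point D (dirac_at z) <-> eigenvector D z.
Proof.
split => [st|]; last exact: eigenvector_stationary.
have zz := (sphereP z).1 hz.
split.
  apply/eqP => z0; move/eqP: zz.
  by rewrite z0 /dotp big1 1?eq_sym ?oner_eq0// => i _; rewrite mxE mul0r.
set a := dotp z (D *m z); exists a.
pose w := D *m z - a *: z.
have wz : dotp w z = 0 by rewrite !dotpE zz mulr1 dotpC subrr.
have [w0|w0] := eqVneq (dotp w w) 0.
  by apply/eqP; rewrite -subr_eq0; apply/eqP/dotp_eq0.
have r0 : enorm w != 0 by rewrite sqrtr_eq0 -ltNge lt_neqAle eq_sym w0 dotp_ge0.
(* The unit vector along w pairs with D z to |w|. *)
have he : sphere R n ((enorm w)^-1 *: w).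
  apply/sphereP; rewrite dotpZl dotpZr mulrA -invfM -expr2 sqr_sqrtr ?dotp_ge0//.
  by rewrite mulVf.
have := stationary_orthogonal hD hz st he; rewrite !dotpZl wz mulr0 => /(_ erefl).
have -> : dotp w (D *m z) = dotp w w.
  by rewrite -[D *m z](subrK (a *: z)) -/w dotpDr dotpZr wz mulr0 addr0.
by move/eqP; rewrite mulf_eq0 invr_eq0 (negbTE r0) (negbTE w0).
Qed.
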